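(* Let $A = (a_{ij})_{i,j=1}^n$ be a real $n \times n$ matrix. If $-A$ is relatively additive $D$-stable for some $\theta$ with $0 \leq \theta < \frac{\pi}{2}$, then $$\det A \leq \left(\frac{\max_i a_{ii}}{\cos \theta}\right)^n.$$
   Context: For $0 < \theta < \frac{\pi}{2}$ let $\mathbb{C}^0_{\theta} = \{z = x+iy \in \mathbb{C} : x < 0,\ x\tan\theta < y < -x\tan\theta\}$ be the open conic sector around the negative real half-axis with apex $0$ and inner angle $2\theta$; for $\theta = 0$, $\mathbb{C}^0_0$ denotes the negative real half-axis $\mathbb{R}^- = (-\infty,0)$. $\sigma(M)$ denotes the set of (complex) eigenvalues of a matrix $M$. A nonnegative diagonal matrix is a diagonal matrix with all diagonal entries $\geq 0$. For a given $\theta$, a real $n\times n$ matrix $M$ is called relatively additive $D$-stable (for this $\theta$) if $\sigma(M - D) \subset \mathbb{C}^0_\theta$ for every nonnegative diagonal matrix $D$. *)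

(* Defs.v *)
From HB Require Import structures.
From mathcomp Require Import all_boot all_order all_algebra.
From mathcomp Require Import complex.
From mathcomp Require Import reals trigo.

Set Implicit Arguments.
Unset Strict Implicit.
Unset Printing Implicit Defensive.

Import Order.TTheory GRing.Theory Num.Theory.
Local Open Scope ring_scope.
Local Open Scope complex_scope.

(* For theta = 0 the sector inequalities would give the empty set; the
   degenerate sector is by convention the open negative real half-axis. *)
Definition sector (R : realType) (theta : R) (z : R[i]) : Prop :=
  if theta == 0 then complex.Im z = 0 /\ complex.Re z < 0
  else complex.Re z < 0 /\
       complex.Re z * tan theta < complex.Im z < - complex.Re z * tan theta.

Definition spectrum (R : realType) (n : nat) (M : 'M[R]_n) (z : R[i]) : Prop :=
  eigenvalue (map_mx (real_complex R) M) z.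

Definition nonneg_diag (R : realType) (n : nat) (D : 'M[R]_n) : Prop :=
  is_diag_mx D /\ forall i, 0 <= D i i.

Definition rel_additive_D_stable (R : realType) (n : nat) (theta : R)
    (M : 'M[R]_n) : Prop :=
  forall D : 'M[R]_n, nonneg_diag D ->
    forall z : R[i], spectrum (M - D) z -> sector theta z.

(* The size is n.+1 so that the maximum is over a nonempty family; the seed
   A ord0 ord0 of the iterated maximum is itself a diagonal entry. *)
Definition max_diag (R : realType) (n : nat) (A : 'M[R]_n.+1) : R :=
  \big[Num.max/A ord0 ord0]_(i < n.+1) A i i.

(* Main.v *)
(* Taking [D = 0], the eigenvalues [z] of [- A] satisfy
   [|z| <= - Re z / cos theta], so [det A], the product of the [- z], is at most
   the product of the [- Re z / cos theta]; by AM-GM this is at most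
   [(tr A / (n cos theta)) ^ n], and [tr A / n] is at most the largest diagonal
   entry. *)
Require Import Defs.
From HB Require Import structures.
From mathcomp Require Import all_boot all_order all_algebra.
From mathcomp Require Import complex.
From mathcomp Require Import reals trigo.
From mathcomp Require Import lra.

Set Implicit Arguments.
Unset Strict Implicit.
Unset Printing Implicit Defensive.

Import Order.TTheory GRing.Theory Num.Theory.
Local Open Scope ring_scope.

Lemma sector_Re_le0 (R : realType) (theta : R) (z : R[i]) :
  sector theta z -> complex.Re z <= 0.
Proof. by rewrite /sector; case: eqP => _ [? ?]; lra. Qed.

(** In the sector [|Im z| <= |Re z| tan theta], so [|z|^2 <= (Re z)^2 (1 + tan^2 theta) = (Re z /
    cos theta)^2]. The norm takes values in [R[i]], hence the embedded bound. *)
Lemma sector_norm_le (R : realType) (theta : R) (z : R[i]) :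
  0 < cos theta -> sector theta z ->
  `|z| <= (- complex.Re z / cos theta)%:C%C.
Proof.
move=> cos_gt0 zS; have x_le0 := sector_Re_le0 zS.
have y_le : complex.Im z ^+ 2 <= (complex.Re z * tan theta) ^+ 2.
  move: zS; rewrite /sector; case: eqP => _.
    by case=> -> _; rewrite expr0n sqr_ge0.
  (* With [x = Re z], [y = Im z], [t = tan theta], the product of the positive gaps [y - x t] and
     [- x t - y] is [(x t)^2 - y^2]. *)
  by case=> _ /andP[? ?]; nra.
have bound_ge0 : 0 <= - complex.Re z / cos theta.
  by rewrite divr_ge0 ?oppr_ge0 // ltW.
rewrite normc_def lecR -(ger0_norm bound_ge0) -sqrtr_sqr ler_sqrt ?sqr_ge0 //.
rewrite exprMn sqrrN exprVn cos2_tan2 ?gt_eqF //; lra.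
Qed.

Lemma prod_le_mean_expn (R : realFieldType) (s : seq R) :
  (forall x, x \in s -> 0 <= x) ->
  \prod_(x <- s) x <= ((\sum_(x <- s) x) / (size s)%:R) ^+ size s.
Proof.
move=> s_ge0; rewrite [\prod_(_ <- _) _](big_nth 0).
rewrite [\sum_(_ <- _) _](big_nth 0) !big_mkord.
have := leif_AGM (A := 'I_(size s)) (E := fun i => nth 0 s i).
rewrite card_ord => AGM; apply: (AGM _).1 => i _.
by apply: s_ge0; exact: mem_nth.
Qed.

(** Comparing degrees gives [size s = n]: [s] lists the eigenvalues with multiplicity. *)
Lemma char_poly_splits (F : closedFieldType) (n : nat) (M : 'M[F]_n) :
  {s : seq F | size s = n & char_poly M = \prod_(z <- s) ('X - z%:P)}.
Proof.
have [s] := closed_field_poly_normal (char_poly M).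
rewrite (monicP (char_poly_monic M)) scale1r => def_p; exists s => //.
by have := size_char_poly M; rewrite def_p size_prod_XsubC => -[].
Qed.

Lemma mean_diag_le_max (R : realType) (n : nat) (A : 'M[R]_n.+1) :
  \tr A / n.+1%:R <= max_diag A.
Proof.
rewrite ler_pdivrMr ?ltr0n // mulr_natr -[X in _ *+ X](card_ord n.+1).
rewrite -sumr_const; apply: ler_sum => i _.
exact: (le_bigmax _ (fun i => A i i)).
Qed.

Theorem theorem4 (R : realType) (n : nat) (A : 'M[R]_n.+1) (theta : R)
  (theta_ge0 : 0 <= theta) (theta_lt : theta < pi / 2)
  (A_stable : rel_additive_D_stable theta (- A)) :
  \det A <= (max_diag A / cos theta) ^+ n.+1.
Proof.
have cos_gt0 : 0 < cos theta by apply: cos_gt0_pihalf; lra.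
have [s size_s def_p] := char_poly_splits (map_mx (real_complex R) (- A)).
have s_sector z : z \in s -> sector theta z.
  move=> zs; apply: (A_stable 0).
    by split=> [|i]; rewrite ?mxE //; exact: mx0_is_diag.
  by rewrite subr0 /spectrum eigenvalue_root_char def_p root_prod_XsubC.
(* Evaluate the characteristic polynomial of [- A] at 0: its constant term is
   [(-1)^n.+1 * \det (- A)], and the two signs cancel. *)
have detA : (\det A)%:C%C = \prod_(z <- s) - z.
  under eq_bigr do rewrite -[- _]add0r -hornerXsubC.
  rewrite -horner_prod -def_p horner_coef0 char_poly_det det_map_mx /=.
  by rewrite -[- A]scaleN1r detZ rmorphM rmorphXn rmorphN1 signrMK.
(* Compare the subleading coefficients, then take real parts. *)
have trA : \sum_(z <- s) - complex.Re z = \tr A.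
  have : \sum_(z <- s) z = (- \tr A)%:C%C.
    apply: oppr_inj; rewrite -coefPn_prod_XsubC ?size_s // -def_p.
    by rewrite char_poly_trace // trace_map_mx raddfN.
  move=> /(congr1 (@complex.Re R)) /=; rewrite raddf_sum sumrN => ->.
  by rewrite opprK.
pose t := [seq - complex.Re z / cos theta | z <- s].
have t_ge0 x : x \in t -> 0 <= x.
  move=> /mapP[z /s_sector /sector_Re_le0 z_le0 ->].
  by rewrite divr_ge0 ?oppr_ge0 // ltW.
have detA_le : \det A <= \prod_(x <- t) x.
  (* Pass to the norm in [R[i]], which is multiplicative over the eigenvalues. *)
  rewrite -lecR (le_trans (real_ler_norm _)) ?complex_real //.
  rewrite detA normr_prod big_map rmorph_prod big_seq [leRHS]big_seq.
  apply: ler_prod => z /s_sector zS; rewrite normr_ge0 normrN.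
  exact: sector_norm_le.
apply: le_trans detA_le (le_trans (prod_le_mean_expn t_ge0) _).
have mean_t_ge0 : 0 <= (\sum_(x <- t) x) / (size t)%:R.
  by rewrite divr_ge0 ?ler0n // big_seq sumr_ge0.
have mean_t_le : (\sum_(x <- t) x) / (size t)%:R <= max_diag A / cos theta.
  rewrite size_map size_s big_map -mulr_suml trA mulrAC.
  by rewrite ler_pM2r ?invr_gt0 ?mean_diag_le_max.
(* Monotonicity of the power needs both bases nonnegative; the right one is so because it dominates
   the mean of [t]. *)
rewrite {2}size_map size_s lerXn2r // nnegrE //.
exact: le_trans mean_t_ge0 mean_t_le.
Qed.
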